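(* For $n\in\mathbb{N}$ let $P_n(x)=\frac{1}{n!}\frac{d^n}{dx^n}[x^n(1-x)^n]$ be the shifted Legendre polynomial and \[\mathfrak{J}_n=\int_{(0,1)^2}-P_n(x)P_n(y)\frac{\log(xy)}{1-xy}\,d(x,y).\] Then $\mathfrak{J}_n>0$ for every $n\in\mathbb{N}$.
   Context: $\log$ is the natural logarithm; the integral is the Lebesgue integral over the open unit square. *)

(* Defs.v *)
From mathcomp Require Import all_boot all_order all_algebra.
From mathcomp Require Import all_classical all_reals all_analysis.

Set Implicit Arguments.
Unset Strict Implicit.
Unset Printing Implicit Defensive.

Import Order.TTheory GRing.Theory Num.Theory.
Import numFieldNormedType.Exports.

Local Open Scope classical_set_scope.
Local Open Scope ring_scope.

(* [derive1n] iterates the analytic derivative of a real function. *)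
Definition shifted_legendre (R : realType) (n : nat) (x : R) : R :=
  (n`!%:R)^-1 * derive1n n (fun t : R => t ^+ n * (1 - t) ^+ n) x.

(* The real-valued integral [Rintegral] is 0 when the extended-real one is
   infinite, so [0 < legendre_log_integral R n] also entails that the integral
   is finite. *)
Definition legendre_log_integral (R : realType) (n : nat) : R :=
  \int[(@lebesgue_measure R \x @lebesgue_measure R)%E]_(z in
      `]0, 1[%classic `*` `]0, 1[%classic)
    (- shifted_legendre n z.1 * shifted_legendre n z.2
     * (ln (z.1 * z.2) / (1 - z.1 * z.2))).

(* Main.v *)
Require Import Defs.
From HB Require Import structures.
From mathcomp Require Import all_boot all_order all_algebra.
From mathcomp Require Import all_classical all_reals all_analysis.
From mathcomp Require Import measurable_realfun.
From mathcomp Require Import ring lra.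

(* Write f(u) = - ln u / (1 - u), b = (1 - X)^n and D h = (-1)^n X^n h^(n) / n!.
   For polynomials h, integrating by parts n times is an identity between
   moments, and gives
     iint P_n(x) P_n(y) h(xy) = iint P_n(x) b(y) (D h)(xy).
   Apply this to the partial sums f_N of f(u) = sum_k (1 - u)^k / (k + 1).  The
   polynomials D f_N have the same limit as the partial sums S_N of
   sum_k B_k (1 - u)^k, where B_k = k! n! / (k + n + 1)!, and everything is
   dominated by the integrable function f(xy), so
     J_n = lim iint P_n(x) b(y) S_N(xy).
   A second integration by parts turns the k-th term of the right-hand side into
     B_k 'C(k, n) iint (1 - x)^n (1 - y)^n (xy)^n (1 - xy)^(k - n),
   which is nonnegative, and positive for k = n.  This replaces Beukers' triple
   integral and change of variables by two expansions in powers of 1 - xy. *)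

Set Implicit Arguments.
Unset Strict Implicit.
Unset Printing Implicit Defensive.

Import Order.TTheory GRing.Theory Num.Theory.
Import numFieldNormedType.Exports.

Local Open Scope classical_set_scope.
Local Open Scope ring_scope.

(** * Moments of polynomials over the unit interval and the unit square *)

Section Functional.
Variable R : numFieldType.
Implicit Types (w : nat -> R) (p q h : {poly R}).

(** The linear functional with ['X^i] sent to [w i]. Integrals of polynomials are encoded through
    their moments, so that integration by parts stays algebraic and needs no measure theory. *)
Definition coef_functional w p : R := \sum_(i < size p) p`_i * w i.

Lemma coef_functionalE w p N : (size p <= N)%N ->
  coef_functional w p = \sum_(i < N) p`_i * w i.
Proof.
move=> pN; rewrite /coef_functional (big_ord_widen _ (fun i => p`_i * w i) pN).
rewrite [RHS](bigID (fun i : 'I_N => (i < size p)%N))/=.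
rewrite [X in _ + X]big1 ?addr0//.
by move=> i; rewrite -leqNgt => pi; rewrite nth_default// mul0r.
Qed.

Lemma coef_functional_is_linear w : scalar (coef_functional w).
Proof.
move=> a p q; pose N := (maxn (size (a *: p + q)) (maxn (size p) (size q))).
rewrite !(@coef_functionalE _ _ N) ?leq_max ?leqnn ?orbT//.
rewrite mulr_sumr -big_split/=; apply: eq_bigr => i _.
by rewrite coefD coefZ mulrDl mulrA.
Qed.

HB.instance Definition _ w := GRing.isLinear.Build R {poly R} R *%R
  (coef_functional w) (coef_functional_is_linear w).

Lemma coef_functionalXn w j : coef_functional w 'X^j = w j.
Proof.
rewrite /coef_functional size_polyXn big_ord_recr/= coefXn eqxx mul1r.
rewrite big1 ?add0r//.
by move=> i _; rewrite coefXn ltn_eqF ?mul0r.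
Qed.

Lemma eq_coef_functional w1 w2 : w1 =1 w2 ->
  coef_functional w1 =1 coef_functional w2.
Proof. by move=> e p; apply: eq_bigr => i _; rewrite e. Qed.

Definition poly_integral := coef_functional (fun i => i.+1%:R^-1).
HB.instance Definition _ := GRing.Linear.on poly_integral.

Lemma poly_integral_deriv p : poly_integral p^`() = p.[1] - p.[0].
Proof.
rewrite -[p]coefK poly_def raddf_sum raddf_sum !horner_sum -sumrB.
apply: eq_bigr => -[i _] _ /=; rewrite derivZ linearZ/= !hornerZ -mulrBr.
congr (_ * _); rewrite derivXn raddfMn/=.
rewrite /poly_integral coef_functionalXn !hornerE.
case: i => [|i]; first by rewrite mulr0n expr0 subrr.
by rewrite expr0n subr0 expr1n/= -[LHS]mulr_natr mulVf// pnatr_eq0.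
Qed.

Lemma poly_integral_by_parts p q : (p * q).[0] = 0 -> (p * q).[1] = 0 ->
  poly_integral (p^`() * q) = - poly_integral (p * q^`()).
Proof.
move=> pq0 pq1; apply/eqP; rewrite -addr_eq0 -raddfD -derivM/=.
by rewrite poly_integral_deriv pq0 pq1 subr0.
Qed.

(** Each derivative lowers the multiplicity of the factor [p] by at most one. As long as [m < n], a
    factor [p] survives and kills the boundary terms of the iterated integration by parts. *)
Lemma derivn_exp_factor p n m : (m <= n)%N ->
  exists q, (p ^+ n)^`(m) = p ^+ (n - m) * q.
Proof.
elim: m => [|m IH] mn; first by exists 1; rewrite derivn0 subn0 mulr1.
have [q e] := IH (ltnW mn).
rewrite derivnS e -(subnSK mn) derivM deriv_exp/=.
exists (p^`() * q *+ (n - m.+1).+1 + p * q^`()).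
by rewrite exprS; ring.
Qed.

Lemma poly_integral_by_parts_iter p n q m :
  p.[0] = 0 -> p.[1] = 0 -> (m <= n)%N ->
  poly_integral ((p ^+ n)^`(m) * q)
  = (-1) ^+ m * poly_integral (p ^+ n * q^`(m)).
Proof.
move=> p0 p1; elim: m q => [|m IH] q mn; first by rewrite !derivn0 expr0 mul1r.
have [r e] := derivn_exp_factor p (ltnW mn).
rewrite derivnS poly_integral_by_parts.
- by rewrite IH ?(ltnW mn)// -derivSn exprS mulN1r mulNr.
- by rewrite e !hornerM horner_exp p0 expr0n subn_eq0 leqNgt mn !mul0r.
- by rewrite e !hornerM horner_exp p1 expr0n subn_eq0 leqNgt mn !mul0r.
Qed.

(** Induction on [b]: integration by parts shows that [a.+1] times the integral for [(a, b.+1)] is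
    [b.+1] times the integral for [(a.+1, b)]. *)
Lemma poly_integral_Xn_onemXn a b :
  0 < poly_integral ('X^a * (1 - 'X) ^+ b).
Proof.
elim: b a => [|b IH] a.
  by rewrite expr0 mulr1 /poly_integral coef_functionalXn invr_gt0 ltr0n.
have : poly_integral (('X^(a.+1))^`() * (1 - 'X) ^+ b.+1)
     = - poly_integral ('X^(a.+1) * ((1 - 'X) ^+ b.+1)^`()).
  rewrite poly_integral_by_parts// !hornerE ?expr0n ?subrr ?expr0n//=;
    by rewrite ?mul0r ?mulr0.
rewrite derivXn deriv_exp derivB derivC derivX sub0r/=.
rewrite mulrnAl raddfMn/= mulN1r.
rewrite mulNrn mulrN raddfN opprK mulrnAr raddfMn/=.
by move=> e; rewrite -(pmulrn_lgt0 _ (ltn0Sn a)) e pmulrn_lgt0.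
Qed.

End Functional.

(** * Legendre moments and the operator D *)

Section Legendre.
Variables (R : numFieldType) (n : nat).
Implicit Types (p q h : {poly R}).

Definition legendre_poly : {poly R} := (('X * (1 - 'X)) ^+ n)^`N(n).

Lemma legendre_polyE :
  legendre_poly = (n`!%:R)^-1 *: (('X * (1 - 'X)) ^+ n)^`(n).
Proof.
rewrite nderivn_def -[_^`N(_) *+ _]scaler_nat scalerA mulVf ?scale1r//.
Qed.

(** Moving the [n] derivatives onto ['X^j] leaves ['C(j, n) * n!] times ['X^(j - n)], and the factor
    ['X^n] of the Rodrigues formula restores ['X^j]. For [j < n] both sides vanish. *)
Lemma legendre_moment j : poly_integral (legendre_poly * 'X^j)
  = (-1) ^+ n * 'C(j, n)%:R * poly_integral ((1 - 'X) ^+ n * 'X^j).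
Proof.
rewrite legendre_polyE -scalerAl linearZ/=.
rewrite poly_integral_by_parts_iter//; last first.
- by rewrite !hornerE subrr.
- by rewrite !hornerE.
rewrite derivnXn mulrnAr raddfMn/= -bin_ffact mulrnA.
have [jn|nj] := ltnP j n.
  by rewrite bin_small// !mulr0n mul0rn !mulr0 mul0r.
rewrite exprMn mulrAC -exprD subnKC// [in RHS](mulrC _ 'X^j).
rewrite -[_ *+ n`!]mulr_natr -[_ *+ 'C(_, _)]mulr_natr.
have : n`!%:R != 0 :> R by rewrite pnatr_eq0 -lt0n fact_gt0.
by move=> ?; field.
Qed.

(* [bilin p q h] is the integral of p(x) q(y) h(xy) over the unit square. *)
Definition bilin p q : {poly R} -> R :=
  coef_functional
    (fun j => poly_integral (p * 'X^j) * poly_integral (q * 'X^j)).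
HB.instance Definition _ p q := GRing.Linear.on (bilin p q).

Lemma bilinC p q h : bilin p q h = bilin q p h.
Proof. by apply: eq_coef_functional => i; rewrite mulrC. Qed.

(** The operator D of the overview. It is diagonal on monomials, and its eigenvalue on ['X^j] is
    exactly the factor occurring in [legendre_moment]. *)
Definition euler_op h : {poly R} := (-1) ^+ n *: ('X^n * h^`N(n)).

Lemma coef_euler_op h j : (euler_op h)`_j = (-1) ^+ n * 'C(j, n)%:R * h`_j.
Proof.
rewrite coefZ coefXnM -mulrA; congr (_ * _); case: ltnP => jn.
  by rewrite bin_small// mul0r.
by rewrite coef_nderivn subnKC// mulr_natl.
Qed.

(** Compared coefficient by coefficient: the factor gained by the moments of [legendre_poly] is
    absorbed into [h] as an eigenvalue of [euler_op]. *)
Lemma bilin_legendre p h :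
  bilin p legendre_poly h = bilin p ((1 - 'X) ^+ n) (euler_op h).
Proof.
pose N := maxn (size h) (size (euler_op h)).
rewrite /bilin !(@coef_functionalE _ _ _ N) ?leq_max ?leqnn ?orbT//.
apply: eq_bigr => j _; rewrite legendre_moment coef_euler_op; ring.
Qed.

Lemma derivn_onemXn k m : ((1 - 'X) ^+ k)^`(m)
  = (-1) ^+ m *: ((1 - 'X) ^+ (k - m)) *+ (k ^_ m) :> {poly R}.
Proof.
elim: m => [|m IH]; first by rewrite derivn0 subn0 ffactn0 expr0 scale1r.
rewrite derivnS IH derivMn derivZ deriv_exp derivB derivC derivX sub0r.
rewrite mulN1r mulNrn scalerN -scaleNr scalerMnr ffactnSr mulnC mulrnA.
rewrite subnS exprS mulN1r.
by rewrite scalerMnr.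
Qed.

(** The sign of D cancels the sign from differentiating powers of [1 - 'X], so the result is
    nonnegative on the unit interval; for [k < n] it is zero. *)
Lemma euler_op_onemXn k : euler_op ((1 - 'X) ^+ k)
  = 'C(k, n)%:R *: ('X^n * (1 - 'X) ^+ (k - n)).
Proof.
have n0 : n`!%:R != 0 :> R by rewrite pnatr_eq0 -lt0n fact_gt0.
rewrite /euler_op; have := nderivn_def n ((1 - 'X) ^+ k : {poly R}).
rewrite derivn_onemXn -bin_ffact mulrnA => /eqP.
rewrite -[X in X == _ -> _]scaler_nat -[X in _ == X -> _]scaler_nat.
rewrite (inj_eq (scalerI n0)) => /eqP <-.
by rewrite mulrnAr -scaler_nat -scalerAr !scalerA mulrAC -expr2 sqrr_sign mul1r.
Qed.

Lemma euler_op_is_linear : linear euler_op.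
Proof.
move=> a p q.
by rewrite /euler_op linearP mulrDr scalerDr -scalerAr !scalerA mulrC.
Qed.
HB.instance Definition _ := GRing.isLinear.Build R {poly R} {poly R} *:%R
  euler_op euler_op_is_linear.

End Legendre.

(** * Power series of the logarithmic kernel *)

Section PowerSeries.
Variable R : realType.
Implicit Types (v u : R) (n k N : nat).

Lemma natr_gt0 n : 0 < n.+1%:R :> R.
Proof. by rewrite ltr0n. Qed.

Lemma eq_cvgn (f g : R ^nat) (a b : R) : f =1 g -> a = b ->
  f @ \oo --> a -> g @ \oo --> b.
Proof. by move=> /funext -> ->. Qed.

Lemma power_partial_sum_nondecreasing (c : nat -> R) v :
  (forall k, 0 <= c k) -> 0 <= v ->
  nondecreasing_seq (fun N => \sum_(k < N) c k * v ^+ k).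
Proof.
move=> c0 v0; apply/nondecreasing_seqP => N.
by rewrite big_ord_recr/= lerDl mulr_ge0 ?exprn_ge0.
Qed.

Lemma cvg_negative_binomial n v : 0 <= v < 1 ->
  (\sum_(m < N) 'C(m + n, n)%:R * v ^+ m) @[N --> \oo] --> (1 - v) ^- n.+1.
Proof.
move=> /andP[v0 v1].
have v1' : 0 < 1 - v by rewrite subr_gt0.
elim: n => [|n IH].
  have := @cvg_geometric_series R 1 v; rewrite ger0_norm// => /(_ v1).
  rewrite expr1 mul1r; apply: cvg_trans; apply: near_eq_cvg; apply: nearW => N.
  rewrite /series/= big_mkord; apply: eq_bigr => k _.
  by rewrite addn0 bin0 mul1r.
set G := (fun N => \sum_(m < N) 'C(m + n, n)%:R * v ^+ m) in IH.
set A := (X in X @ _).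
have nnc j l : (0 : R) <= 'C(j, l)%:R * v ^+ l by rewrite mulr_ge0 ?exprn_ge0.
(* Pascal's rule turns multiplication by [1 - v] into a passage from [n.+1] to [n], up to one
   boundary term. *)
have AE N : (1 - v) * A N = G N - 'C(N + n, n.+1)%:R * v ^+ N.
  elim: N => [|N IHN].
    by rewrite /A /G !big_ord0 add0n bin_small// mul0r subrr mulr0.
  have -> : A N.+1 = A N + 'C(N + n.+1, n.+1)%:R * v ^+ N.
    by rewrite /A big_ord_recr.
  have -> : G N.+1 = G N + 'C(N + n, n)%:R * v ^+ N by rewrite /G big_ord_recr.
  rewrite mulrDr IHN addSnnS addnS binS natrD exprS; ring.
have Ab N : A N <= (1 - v)^-1 * (1 - v) ^- n.+1.
  rewrite ler_pdivlMl// AE.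
  apply: (@le_trans _ _ (G N)); first by rewrite gerBl mulr_ge0 ?exprn_ge0.
  have <- : limn G = (1 - v) ^- n.+1 by apply/cvg_lim.
  apply: nondecreasing_cvgn_le; last by apply/cvg_ex; exists ((1 - v) ^- n.+1).
  exact: (@power_partial_sum_nondecreasing (fun m => 'C(m + n, n)%:R)).
have cA : cvgn A.
  apply: nondecreasing_is_cvgn; first exact:
    (@power_partial_sum_nondecreasing (fun m => 'C(m + n.+1, n.+1)%:R)).
  by exists ((1 - v)^-1 * (1 - v) ^- n.+1) => _ [N _ <-].
(* After a shift, the boundary term is [v] times the general term of the convergent series [A]. *)
have t0 : 'C(N + n, n.+1)%:R * v ^+ N @[N --> \oo] --> (0 : R).
  rewrite -cvg_shiftS/=.
  have : v * ('C(N + n.+1, n.+1)%:R * v ^+ N) @[N --> \oo] --> v * 0.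
    apply: cvgMl_tmp; apply: cvg_series_cvg_0; rewrite (_ : series _ = A)//.
    by apply/funext => N; rewrite /series/= big_mkord.
  by apply: eq_cvgn; rewrite ?mulr0// => N; rewrite addSnnS exprS mulrCA.
apply: (eq_cvgn _ _ (cvgMl_tmp (a := (1 - v)^-1) (cvgB IH t0))) => [N|].
  by rewrite -[RHS](mulKf (lt0r_neq0 v1')) AE.
by rewrite subr0 [in RHS]exprS invfM.
Qed.

(* [beta_coef k n] is the integral of w^k (1-w)^n over [0,1]. *)
Definition beta_coef k n : R := (k`! * n`!)%:R / (k + n).+1`!%:R.

Lemma beta_coef_gt0 k n : 0 < beta_coef k n.
Proof. by rewrite divr_gt0// ltr0n ?muln_gt0 ?fact_gt0. Qed.

(** This is [(1 - w)^(n+1) = (1 - w)^n - w (1 - w)^n] multiplied by [w^k] and integrated. *)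
Lemma beta_coefS k n : beta_coef k n.+1 = beta_coef k n - beta_coef k.+1 n.
Proof.
rewrite /beta_coef addnS addSn.
rewrite ![in (k + n).+2`!]factS !factS !natrM.
have f0 : (k + n)`!%:R != 0 :> R by rewrite pnatr_eq0 -lt0n fact_gt0.
have e : ((k + n).+2%:R : R) = k%:R + n%:R + 2 by rewrite -addn2 !natrD.
have e1 : ((k + n).+1%:R : R) = k%:R + n%:R + 1 by rewrite -addn1 !natrD.
rewrite e e1 -(natr1 n) -(natr1 k).
have h2 : k%:R + n%:R + 2 != 0 :> R by rewrite -e pnatr_eq0.
have h1 : k%:R + n%:R + 1 != 0 :> R by rewrite -e1 pnatr_eq0.
by field; rewrite f0 h1 h2.
Qed.

Lemma beta_coef0n n : beta_coef 0 n = n.+1%:R^-1.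
Proof.
rewrite /beta_coef fact0 mul1n add0n factS natrM invfM mulrCA divff ?mulr1//.
Qed.

Lemma beta_coef_le k n : beta_coef k n <= k.+1%:R^-1.
Proof.
elim: n => [|n IH]; last first.
  by rewrite beta_coefS (le_trans _ IH)// gerBl ltW ?beta_coef_gt0.
rewrite /beta_coef fact0 muln1 addn0 factS natrM invfM mulrCA divff ?mulr1//.
Qed.

(** With [k = m + n], D maps the term [(1 - u)^k / (k + 1)] to [u^n (1 - u)^m] times this
    coefficient. *)
Definition binomial_coef n m : R := 'C(m + n, n)%:R / (m + n).+1%:R.

(** Induction on [n]. For [n = 0] the two sums agree term by term; the step expresses the new
    difference through the old one and a negative binomial partial sum. *)
Lemma cvg_binomial_beta_diff n v : 0 < v < 1 ->
  ((1 - v) ^+ n * (\sum_(m < N) binomial_coef n m * v ^+ m)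
    - \sum_(k < N) beta_coef k n * v ^+ k) @[N --> \oo] --> (0 : R).
Proof.
move=> /andP[v0 v1]; elim: n => [|n IH].
  rewrite (_ : (fun _ => _) = cst 0); first exact: cvg_cst.
  apply/funext => N; rewrite expr0 mul1r -sumrB big1// => k _.
  rewrite /binomial_coef bin0 addn0 /beta_coef fact0 muln1 addn0 factS natrM.
  have f0 : k`!%:R != 0 :> R by rewrite pnatr_eq0 -lt0n fact_gt0.
  have := natr_gt0 k; move/lt0r_neq0 => k0.
  by field; rewrite f0 addrC natr1 k0.
set d := (X in X @ _) in IH.
set d' := (X in X @ _).
pose G N := \sum_(m < N) 'C(m + n, n)%:R * v ^+ m.
(* Summed form of the recurrences [e4] and [beta_coefS]. Both relate index [N] at level [n.+1] to
   index [N.+1] at level [n], whence the factor [v] and the shifted arguments. All three terms on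
   the right tend to 0. *)
have E N : v * d' N = ((1 - v) ^+ n.+1 * G N.+1 - 1) / n.+1%:R
    - (1 - v) * d N.+1 + beta_coef N n * v ^+ N.+1.
  have n0 := lt0r_neq0 (natr_gt0 n).
  elim: N => [|N IHN].
    rewrite /d' /d /G !big_ord_recr !big_ord0/= expr0 /binomial_coef add0n binn.
    by rewrite beta_coef0n exprS; field; rewrite addrC natr1.
  have e1 : d' N.+1 = d' N + ((1 - v) ^+ n.+1 * (binomial_coef n.+1 N * v ^+ N)
      - beta_coef N n.+1 * v ^+ N).
    by rewrite /d' !big_ord_recr/=; ring.
  have e2 : d N.+2 = d N.+1 + ((1 - v) ^+ n * (binomial_coef n N.+1 * v ^+ N.+1)
      - beta_coef N.+1 n * v ^+ N.+1).
    by rewrite /d !big_ord_recr/=; ring.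
  have e3 : G N.+2 = G N.+1 + 'C(N.+1 + n, n)%:R * v ^+ N.+1.
    by rewrite /G big_ord_recr.
  have nN : (N + n).+2%:R = N%:R + n%:R + 2 :> R by rewrite -addn2 !natrD.
  have e4 : binomial_coef n.+1 N
      = 'C(N.+1 + n, n)%:R / n.+1%:R - binomial_coef n N.+1.
    rewrite /binomial_coef addSn addnS.
    have nN0 := lt0r_neq0 (natr_gt0 (N + n).+1).
    have : 'C((N + n).+1, n.+1)%:R * n.+1%:R
        = 'C((N + n).+1, n)%:R * N.+1%:R :> R.
      by rewrite -!natrM mulnC mul_bin_left subSn ?leq_addl// addnK mulnC.
    rewrite -(natr1 n) -(natr1 N) nN => e.
    apply: (mulIf n0); rewrite -(natr1 n) mulrAC e.
    have := n0; have := nN0; rewrite nN -(natr1 n) => h1 h2.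
    by field; rewrite h1 h2.
  rewrite e1 e2 e3 mulrDr IHN e4 beta_coefS !exprS; ring.
have t0 : beta_coef N n * v ^+ N.+1 @[N --> \oo] --> (0 : R).
  apply: (@squeeze_cvgr _ _ _ _ (cst 0) (fun N => v ^+ N)).
  - apply: nearW => N /=.
    rewrite mulr_ge0 ?exprn_ge0 ?(ltW v0) ?(ltW (beta_coef_gt0 _ _))//=.
    rewrite exprS mulrA ler_piMl ?exprn_ge0 ?(ltW v0)//.
    rewrite mulr_ile1 ?(ltW v0) ?(ltW v1) ?(ltW (beta_coef_gt0 _ _))//.
    by rewrite (le_trans (beta_coef_le _ _))// invf_le1 ?ler1n ?natr_gt0.
  - exact: cvg_cst.
  - by apply: cvg_expr; rewrite ger0_norm// ltW.
have v01 : 0 <= v < 1 by rewrite ltW.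
have c1 : ((1 - v) ^+ n.+1 * G N.+1 - 1) / n.+1%:R @[N --> \oo]
    --> ((1 - v) ^+ n.+1 * (1 - v) ^- n.+1 - 1) / n.+1%:R.
  apply: cvgMr_tmp; apply: cvgB; last exact: cvg_cst.
  by apply: cvgMl_tmp; rewrite (cvg_shiftS G); exact: cvg_negative_binomial.
have c2 : (1 - v) * d N.+1 @[N --> \oo] --> (1 - v) * 0.
  by apply: cvgMl_tmp; rewrite cvg_shiftS.
apply: (eq_cvgn _ _ (cvgMl_tmp (a := v^-1) (cvgD (cvgB c1 c2) t0))) => [N|].
  by rewrite -[RHS](mulKf (lt0r_neq0 v0)) E.
rewrite divff ?subrr ?mul0r ?mulr0 ?subr0 ?addr0 ?mulr0//.
by rewrite expf_neq0// subr_eq0 gt_eqF.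
Qed.

Definition log_kernel u : R := - ln u / (1 - u).

Lemma cvg_log_series u : 0 < u < 1 ->
  (\sum_(k < N) (1 - u) ^+ k / k.+1%:R) @[N --> \oo] --> log_kernel u.
Proof.
move=> /andP[u0 u1].
have v0 : 0 < 1 - u by rewrite subr_gt0.
have v1 : 1 - u < 1 by rewrite gtrBl.
(* The Taylor remainder of [ln] at 1: its derivative collapses to [(1 - x)^N / x] by the geometric
   sum, and [g N 1 = 0], so the mean value theorem on [[u, 1]] bounds it. *)
pose g N (x : R) := ln x + \sum_(k < N) (1 - x) ^+ k.+1 / k.+1%:R.
have dg N (x : R) : 0 < x -> is_derive x 1 (g N) ((1 - x) ^+ N / x).
  move=> x0; elim: N => [|N IHN].
    rewrite expr0 mul1r (_ : g 0 = @ln R); first exact: is_derive1_ln.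
    by apply/funext => y; rewrite /g big_ord0 addr0.
  have d1 : is_derive x (1 : R) (cst 1 - id : R -> R) (-1).
    apply: is_derive_eq
      (is_deriveB (is_derive_cst (1 : R) x 1) (is_derive_id x 1)) _.
    by rewrite sub0r.
  have := is_deriveD IHN (is_deriveZ N.+1%:R^-1 (is_deriveX N.+1 d1)).
  rewrite (_ : g N + _ = g N.+1); last first.
    apply/funext => y; rewrite /g big_ord_recr/= [in RHS]addrA exprfctE/=.
    by congr (_ + _); rewrite mulrC.
  move/is_derive_eq; apply.
  rewrite /GRing.scale/= (_ : (cst 1 - id) x = 1 - x)//.
  by rewrite exprS; field; rewrite addrC natr1 !gt_eqF// natr_gt0.
have b N : `|g N u| <= (1 - u) ^+ N.+1 / u.
  have dgi x : x \in `]u, 1[%R -> is_derive x 1 (g N) ((1 - x) ^+ N / x).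
    by rewrite in_itv/= => /andP[ux _]; apply: dg; exact: lt_trans ux.
  have cg : {within `[u, 1], continuous (g N)}.
    apply: continuous_in_subspaceT => x; rewrite inE/= in_itv/= => /andP[ux _].
    apply/differentiable_continuous/derivable1_diffP.
    by case: (dg N x (lt_le_trans u0 ux)).
  have [c] := MVT u1 dgi cg; rewrite in_itv/= => /andP[uc c1].
  rewrite {1}/g ln1 add0r big1 ?sub0r; last first.
    by move=> k _; rewrite subrr expr0n/= mul0r.
  move=> e; rewrite -normrN e.
  have c0 : 0 < c := lt_trans u0 uc.
  have c1' : 0 <= 1 - c by rewrite subr_ge0 ltW.
  rewrite ger0_norm ?mulr_ge0 ?exprn_ge0 ?invr_ge0 ?(ltW c0) ?(ltW v0)//.
  rewrite [in leRHS]exprSr [in leRHS]mulrAC ler_wpM2r ?(ltW v0)//.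
  apply: ler_pM; rewrite ?exprn_ge0 ?invr_ge0 ?(ltW c0)//.
    by rewrite lerXn2r ?nnegrE ?(ltW v0)// lerD2l lerN2 ltW.
  by rewrite lef_pV2 ?posrE// ltW.
have g0 : g ^~ u @ \oo --> (0 : R).
  apply: norm_cvg0.
  apply: (@squeeze_cvgr _ _ _ _ (cst 0) (fun N => (1 - u) ^+ N.+1 / u)).
  - by apply: nearW => N /=; rewrite normr_ge0 b.
  - exact: cvg_cst.
  - rewrite -[X in _ --> X](mul0r u^-1); apply: cvgMr_tmp.
    rewrite (cvg_shiftS (GRing.exp (1 - u))); apply: cvg_expr.
    by rewrite ger0_norm// ltW.
apply: (eq_cvgn _ _ (cvgMl_tmp (a := (1 - u)^-1)
    (cvgB g0 (cvg_cst (ln u))))) => [N|]; last by rewrite sub0r mulrC.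
rewrite /g addrAC subrr add0r mulr_sumr; apply: eq_bigr => k _.
by rewrite exprS -mulrA mulKf// gt_eqF.
Qed.

(** At [u = x y] this majorant splits into a function of [x] times a function of [y], which makes
    integrability a one-variable question. The bound is [- ln s <= 1/s - 1] for [s] the square root
    of [u]. *)
Lemma log_kernel_le u : 0 < u < 1 -> log_kernel u <= 2 / Num.sqrt u.
Proof.
move=> /andP[u0 u1].
pose s := Num.sqrt u; have s0 : 0 < s by rewrite sqrtr_gt0.
have us : u = s ^+ 2 by rewrite sqr_sqrtr// ltW.
have s1 : s < 1 by rewrite -sqrtr1 ltr_sqrt.
rewrite /log_kernel -/s us lnXn// ler_pdivrMr; last by rewrite -us subr_gt0.
have h : - ln s <= s^-1 - 1.
  rewrite -lnV ?posrE// -[X in ln X](subrKC 1).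
  by apply: le_ln1Dx; rewrite ltrBrDl subrr invr_gt0.
have -> : 2 / s * (1 - s ^+ 2) = 2 * (s^-1 - 1) + 2 * (1 - s).
  by field; rewrite gt_eqF.
have := s1; rewrite -subr_gt0 => s1'.
by move: h s1'; set l := ln s; set t := s^-1; lra.
Qed.

End PowerSeries.

(** * Lebesgue integration over the unit square *)

Section DoubleIntegral.
Variable R : realType.
Notation mu := (@lebesgue_measure R).
Notation mu2 := (@lebesgue_measure R \x @lebesgue_measure R)%E.
Notation I01 := (`]0, 1[%classic : set R).
Notation Q := (`]0, 1[%classic `*` `]0, 1[%classic : set (R * R)).

Lemma ge0_integral_tensor (A B : set R) (a b : R -> R) :
  measurable A -> measurable B -> measurable_fun A a -> measurable_fun B b ->
  (forall x, A x -> 0 <= a x) -> (forall x, B x -> 0 <= b x) ->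
  (\int[mu2]_(z in A `*` B) (a z.1 * b z.2)%:E
   = (\int[mu]_(x in A) (a x)%:E) * (\int[mu]_(x in B) (b x)%:E))%E.
Proof.
move=> mA mB ma mb a0 b0.
(* Extension by zero, because Tonelli is applied on the whole plane. *)
pose a' : R -> R := a \_ A; pose b' : R -> R := b \_ B.
have ma' : measurable_fun [set: R] a' by apply/(measurable_restrictT _ _).1.
have mb' : measurable_fun [set: R] b' by apply/(measurable_restrictT _ _).1.
have a0' x : 0 <= a' x by rewrite /a' patchE; case: ifPn => // /set_mem/a0.
have b0' x : 0 <= b' x by rewrite /b' patchE; case: ifPn => // /set_mem/b0.
have -> : (\int[mu]_(x in A) (a x)%:E = \int[mu]_x (a' x)%:E)%E.
  by rewrite integral_mkcond restrict_EFin.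
have -> : (\int[mu]_(x in B) (b x)%:E = \int[mu]_x (b' x)%:E)%E.
  by rewrite integral_mkcond restrict_EFin.
have -> : (\int[mu2]_(z in A `*` B) (a z.1 * b z.2)%:E
    = \int[mu2]_z (a' z.1 * b' z.2)%:E)%E.
  rewrite integral_mkcond; congr integral; apply/funext => -[x y].
  rewrite /a' /b' !patchE/= in_setX/=.
  have p0 : point = 0 :> R by [].
  by case: (x \in A); case: (y \in B); rewrite //= ?p0 ?mul0r ?mulr0.
pose ab : R * R -> \bar R := fun z => (a' z.1 * b' z.2)%:E.
have mab : measurable_fun [set: R * R] ab.
  apply/measurable_EFinP; apply: measurable_funM.
  + exact: measurableT_comp measurable_fst.
  + exact: measurableT_comp measurable_snd.
have ab0 z : (0 <= ab z)%E.
  by rewrite /= lee_fin mulr_ge0.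
rewrite (@fubini_tonelli1 _ _ _ _ R mu mu ab mab ab0).
rewrite -ge0_integralZr//; last first.
- by apply: integral_ge0 => y _; rewrite lee_fin.
- by move=> y _; rewrite lee_fin.
- exact/measurable_EFinP.
apply: eq_integral => x _; rewrite /fubini_F /ab/=.
under eq_integral do rewrite EFinM.
rewrite ge0_integralZl//.
- exact/measurable_EFinP.
- by move=> y _; rewrite lee_fin.
- by rewrite lee_fin.
Qed.

Lemma integral_exprn i : (\int[mu]_(x in I01) (x ^+ i)%:E = (i.+1%:R^-1)%:E)%E.
Proof.
rewrite integral_itv_bndo_bndc; last first.
  by apply/measurable_EFinP; exact: exprn_measurable.
rewrite integral_itv_obnd_cbnd; last first.
  by apply/measurable_EFinP; exact: exprn_measurable.
have i0 : i.+1%:R != 0 :> R by rewrite pnatr_eq0.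
have d (x : R) : is_derive x 1 (fun x : R => x ^+ i.+1 / i.+1%:R) (x ^+ i).
  have := is_deriveZ i.+1%:R^-1 (is_deriveX i.+1 (is_derive_id x (1 : R))).
  rewrite (_ : _ \*: _ = (fun x : R => x ^+ i.+1 / i.+1%:R)); last first.
    by apply/funext => y; rewrite /= exprfctE mulrC.
  by move/is_derive_eq; apply; rewrite /GRing.scale/= mulr1 mulKf.
have cF : continuous (fun x : R => x ^+ i.+1 / i.+1%:R).
  move=> x; apply: differentiable_continuous; apply/derivable1_diffP.
  by case: (d x).
rewrite (@continuous_FTC2 _ _ (fun x : R => x ^+ i.+1 / i.+1%:R))//=.
- by rewrite expr1n expr0n/= mul0r sube0 mul1r.
- by apply: continuous_subspaceT; exact: exprn_continuous.
- split => [x _||]; first by case: (d x).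
    by apply: cvg_at_right_filter; exact: cF.
  by apply: cvg_at_left_filter; exact: cF.
- by move=> x _; rewrite derive1E; case: (d x).
Qed.

Lemma measurable_inv_sqrt : measurable_fun I01 (fun x : R => (Num.sqrt x)^-1).
Proof.
apply: open_continuous_measurable_fun; first exact: interval_open.
move=> x; rewrite inE/= in_itv/= => /andP[x0 _].
by apply: cvgV; [rewrite gt_eqF// sqrtr_gt0|exact: sqrt_continuous].
Qed.

(** The integrand blows up at 0, so the interval is exhausted by [[1/(i+2), 1]], where the
    antiderivative [2 * Num.sqrt x] applies, and monotone convergence concludes. The offset 2 keeps
    the left endpoint below 1. *)
Lemma integral_inv_sqrt_le2 :
  (\int[mu]_(x in I01) ((Num.sqrt x)^-1)%:E <= 2%:E)%E.
Proof.
pose F i := `[(i.+2%:R^-1 : R), 1]%classic.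
have bF : I01 `<=` \bigcup_i F i.
  move=> x/=; rewrite in_itv/= => /andP[x0 x1].
  exists (Num.truncn x^-1) => //; rewrite /F/= in_itv/= (ltW x1) andbT.
  by rewrite invf_ple ?posrE// ltW// (lt_trans (truncnS_gt _))// ltr_nat.
have i0 i : 0 < i.+2%:R^-1 :> R by rewrite invr_gt0 ltr0n.
have i1 i : i.+2%:R^-1 < 1 :> R by rewrite invf_lt1 ?ltr1n// ltr0n.
have mF i : measurable (F i) by exact: measurable_itv.
have ndF : nondecreasing_seq F.
  move=> i j ij; apply/subsetPset => x; rewrite /F/= !in_itv/= => /andP[ix ->].
  by rewrite andbT (le_trans _ ix)// lef_pV2 ?posrE ?ltr0n// ler_nat.
have cinv (y : R) : 0 < y ->
    {for y, continuous (fun t : R => (Num.sqrt t)^-1)}.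
  move=> y0; apply: cvgV; first by rewrite gt_eqF// sqrtr_gt0.
  exact: sqrt_continuous.
have cF i : {within F i, continuous (fun x : R => (Num.sqrt x)^-1)}.
  apply: continuous_in_subspaceT => x; rewrite inE /F/= in_itv/= => /andP[ix _].
  by apply: cinv; exact: lt_le_trans (i0 i) ix.
have mfF i : measurable_fun (F i) (fun x : R => ((Num.sqrt x)^-1)%:E).
  apply/measurable_EFinP; exact: subspace_continuous_measurable_fun.
have f0 i (x : R) : F i x -> (0 <= ((Num.sqrt x)^-1)%:E)%E.
  by move=> _; rewrite lee_fin invr_ge0 sqrtr_ge0.
apply: (@le_trans _ _ (\int[mu]_(x in \bigcup_i F i) ((Num.sqrt x)^-1)%:E)%E).
  apply: ge0_subset_integral => //.
  - by apply: bigcup_measurable => i _; exact: mF.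
  - by apply/measurable_fun_bigcup.
have h := ge0_nondecreasing_set_cvg_integral (mu := mu) ndF mF mfF f0.
rewrite -(cvg_lim _ h)//; apply: lime_le.
  by apply/cvg_ex; eexists; exact: h.
apply: nearW => i.
have d (x : R) : 0 < x ->
    is_derive x 1 (fun x => 2 * Num.sqrt x) (Num.sqrt x)^-1.
  move=> x0; have := is_deriveZ (2 : R) (is_derive1_sqrt x0).
  by move/is_derive_eq; apply; rewrite /GRing.scale/= invfM mulrA divff ?mul1r.
have cs : continuous (fun x : R => 2 * Num.sqrt x).
  by move=> x; apply: cvgMl_tmp; exact: sqrt_continuous.
rewrite (@continuous_FTC2 _ _ (fun x : R => 2 * Num.sqrt x))//=.
- by rewrite -EFinB lee_fin sqrtr1 mulr1 gerBl mulr_ge0// sqrtr_ge0.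
- exact: cF.
- split => [x||].
  + by rewrite in_itv/= => /andP[ix _]; case: (d x (lt_trans (i0 i) ix)).
  + by apply: cvg_at_right_filter; exact: cs.
  + by apply: cvg_at_left_filter; exact: cs.
- move=> x; rewrite in_itv/= => /andP[ix _]; rewrite derive1E.
  by case: (d x (lt_trans (i0 i) ix)).
Qed.

Definition has_integral2 (F : R * R -> R) (v : R) :=
  mu2.-integrable Q (EFin \o F) /\ (\int[mu2]_(z in Q) (F z)%:E = v%:E)%E.

Lemma measurable_square : measurable Q.
Proof. exact: measurableX. Qed.
Hint Resolve measurable_square : core.

Lemma has_integral2D F G u v : has_integral2 F u -> has_integral2 G v ->
  has_integral2 (fun z => F z + G z) (u + v).
Proof.
move=> [iF eF] [iG eG]; split; last by rewrite integralD_EFin// eF eG.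
by rewrite (_ : _ \o _ = (EFin \o F) \+ (EFin \o G))%E//; exact: integrableD.
Qed.

Lemma has_integral2Z c F u : has_integral2 F u ->
  has_integral2 (fun z => c * F z) (c * u).
Proof.
move=> [iF eF]; split.
  rewrite (_ : _ \o _ = fun z => (c%:E * (EFin \o F) z)%E)//.
  exact: integrableZl.
under eq_integral do rewrite EFinM.
by rewrite integralZl// eF.
Qed.

Lemma eq_has_integral2 F G u v : F =1 G -> u = v ->
  has_integral2 F u -> has_integral2 G v.
Proof. by move=> /funext -> ->. Qed.

Lemma has_integral2_sum N (F : nat -> R * R -> R) v :
  (forall i, has_integral2 (F i) (v i)) ->
  has_integral2 (fun z => \sum_(i < N) F i z) (\sum_(i < N) v i).
Proof.
move=> h; elim: N => [|N IH].
  apply: (eq_has_integral2 _ _ (has_integral2Z 0 (h 0))) => [z|];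
    by rewrite big_ord0 mul0r.
by apply: (eq_has_integral2 _ _ (has_integral2D IH (h N))) => [z|];
  rewrite big_ord_recr.
Qed.

Lemma has_integral2_monomial i j :
  has_integral2 (fun z => z.1 ^+ i * z.2 ^+ j) (i.+1%:R^-1 * j.+1%:R^-1).
Proof.
have p0 k x : I01 x -> 0 <= x ^+ k.
  by rewrite /= in_itv/= => /andP[x0 _]; rewrite exprn_ge0 ?ltW.
have e : (\int[mu2]_(z in Q) (z.1 ^+ i * z.2 ^+ j)%:E
    = (i.+1%:R^-1 * j.+1%:R^-1)%:E)%E.
  rewrite (@ge0_integral_tensor I01 I01 (fun x => x ^+ i) (fun x => x ^+ j))//.
  - by rewrite !integral_exprn.
  - exact: p0.
  - exact: p0.
split => //; apply/integrableP; split.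
  apply/measurable_EFinP; apply: measurable_funTS; apply: measurable_funM.
    exact: measurableT_comp (exprn_measurable _) measurable_fst.
  exact: measurableT_comp (exprn_measurable _) measurable_snd.
under eq_integral => z /set_mem[z1 z2].
  rewrite /= ger0_norm; last by rewrite mulr_ge0 ?p0.
  over.
by rewrite e ltry.
Qed.

Lemma has_integral2_tensor (p q : {poly R}) :
  has_integral2 (fun z => p.[z.1] * q.[z.2])
    (poly_integral p * poly_integral q).
Proof.
have h i j := has_integral2Z (p`_i * q`_j) (has_integral2_monomial i j).
have h2 i := has_integral2_sum (size q) (h i).
have h3 := has_integral2_sum (size p) h2.
apply: (eq_has_integral2 _ _ h3) => [z|].
  rewrite !horner_coef mulr_suml; apply: eq_bigr => i _.
  by rewrite mulr_sumr; apply: eq_bigr => j _; rewrite mulrACA.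
rewrite mulr_suml; apply: eq_bigr => i _.
by rewrite mulr_sumr; apply: eq_bigr => j _; rewrite mulrACA.
Qed.

(** The bridge from the moment algebra to the Lebesgue integral: expand [h] in monomials, each of
    which is a tensor product. *)
Lemma has_integral2_bilin (p q h : {poly R}) :
  has_integral2 (fun z => p.[z.1] * q.[z.2] * h.[z.1 * z.2]) (bilin p q h).
Proof.
have h1 k := has_integral2Z h`_k (has_integral2_tensor (p * 'X^k) (q * 'X^k)).
apply: (eq_has_integral2 _ _ (has_integral2_sum (size h) h1)) => [z|//].
rewrite [h.[_]]horner_coef mulr_sumr; apply: eq_bigr => k _.
by rewrite !hornerM !hornerXn exprMn; ring.
Qed.

Lemma bilin_ge0 (p q h : {poly R}) : (forall x, 0 < x < 1 -> 0 <= p.[x]) ->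
  (forall x, 0 < x < 1 -> 0 <= q.[x]) -> (forall x, 0 < x < 1 -> 0 <= h.[x]) ->
  0 <= bilin p q h.
Proof.
move=> p0 q0 h0; have [_ e] := has_integral2_bilin p q h.
rewrite -lee_fin -e; apply: integral_ge0 => -[x y] [/=].
rewrite !in_itv/= => x01 y01; rewrite lee_fin !mulr_ge0 ?p0 ?q0 ?h0//.
move: x01 y01 => /andP[x0 x1] /andP[y0 y1].
by rewrite mulr_gt0//= mulr_ilt1 ?ltW.
Qed.

(** Dominated convergence, with the majorant obtained from [log_kernel_le]; [C] may have any sign,
    so the majorant uses its absolute value. *)
Lemma cvg_has_integral2 (F_ : nat -> R * R -> R) F v C :
  (forall N, has_integral2 (F_ N) (v N)) ->
  (forall z, Q z -> F_ N z @[N --> \oo] --> F z) ->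
  (forall N z, Q z -> `|F_ N z| <= C * log_kernel (z.1 * z.2)) ->
  v N @[N --> \oo] --> (\int[mu2]_(z in Q) F z)%R.
Proof.
move=> iF cF bF.
pose g (z : R * R) := `|C| * (2 * ((Num.sqrt z.1)^-1 * (Num.sqrt z.2)^-1)).
pose r (z : R * R) := (Num.sqrt z.1)^-1 * (Num.sqrt z.2)^-1.
have s0 (x : R) : 0 <= (Num.sqrt x)^-1 by rewrite invr_ge0 sqrtr_ge0.
have ir : mu2.-integrable Q (EFin \o r).
  apply/integrableP; split.
    apply/measurable_EFinP; apply: measurable_funM.
      apply: (measurable_comp _ _ measurable_inv_sqrt) => //;
        last exact: measurable_funTS.
      by move=> _ [z [z1 z2] <-].
    apply: (measurable_comp _ _ measurable_inv_sqrt) => //;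
        last exact: measurable_funTS.
    by move=> _ [z [z1 z2] <-].
  under eq_integral => z _ do rewrite /= ger0_norm ?mulr_ge0//.
  rewrite (@ge0_integral_tensor I01 I01
    (fun x => (Num.sqrt x)^-1) (fun x => (Num.sqrt x)^-1))//.
  - apply: (@le_lt_trans _ _ (2%:E * 2%:E)%E); last by rewrite -EFinM ltry.
    apply: lee_pmul; rewrite ?integral_inv_sqrt_le2//;
      by apply: integral_ge0 => x _; rewrite lee_fin.
  - exact: measurable_inv_sqrt.
  - exact: measurable_inv_sqrt.
have ig : mu2.-integrable Q (EFin \o g).
  rewrite (_ : _ \o _ = fun z => ((`|C| * 2)%:E * (EFin \o r) z)%E); last first.
    by apply/funext => z; rewrite /= -EFinM -mulrA.
  exact: integrableZl.
have gb N z : Q z -> `|F_ N z| <= g z.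
  move=> Qz; have [z1 z2] := Qz; apply: (le_trans (bF N z Qz)).
  move: z1 z2; rewrite /= !in_itv/= => /andP[x0 x1] /andP[y0 y1].
  have u01 : 0 < z.1 * z.2 < 1 by rewrite mulr_gt0//= mulr_ilt1 ?ltW.
  have k0 : 0 <= log_kernel (z.1 * z.2).
    move/andP: u01 => [u0 u1].
    by rewrite divr_ge0 ?subr_ge0 ?(ltW u1)// oppr_ge0 ln_le0// ltW.
  apply: (@le_trans _ _ (`|C| * log_kernel (z.1 * z.2))).
    by rewrite ler_wpM2r// ler_norm.
  rewrite /g ler_wpM2l// (le_trans (log_kernel_le u01))//.
  by rewrite sqrtrM ?(ltW x0)// invfM.
have mF_ N : measurable_fun Q (EFin \o F_ N) by exact: measurable_int (iF N).1.
have cE z : Q z -> (EFin \o F_ N) z @[N --> \oo] --> (EFin \o F) z.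
  by move=> Qz; apply: cvg_EFin; [exact: nearW|exact: cF].
have [] := @dominated_convergence _ _ R mu2 Q measurable_square
   (fun N => EFin \o F_ N) (EFin \o F) (EFin \o g).
- exact: mF_.
- exact: (emeasurable_fun_cvg _ _ mF_ cE).
- exact: aeW.
- exact: ig.
- by apply: aeW => z N Qz; rewrite /= lee_fin gb.
move=> iFF _ h.
have hv : (v N)%:E @[N --> \oo] --> (\int[mu2]_(z in Q) F z)%:E.
  rewrite /Rintegral fineK; last exact: integrable_fin_num.
  apply: cvg_trans h; apply: near_eq_cvg; apply: nearW => N.
  by rewrite /= (iF N).2.
exact: (fine_cvg hv).
Qed.

End DoubleIntegral.

(** * Positivity *)

Section Positivity.
Variables (R : realType) (n : nat).
Notation mu2 := (@lebesgue_measure R \x @lebesgue_measure R)%E.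
Notation Q := (`]0, 1[%classic `*` `]0, 1[%classic : set (R * R)).
Notation P := (legendre_poly R n).
Notation b := ((1 - 'X) ^+ n : {poly R}).

Lemma shifted_legendreE (x : R) : shifted_legendre n x = P.[x].
Proof.
rewrite legendre_polyE hornerZ; congr (_ * _).
have -> : (fun t : R => t ^+ n * (1 - t) ^+ n) = horner (('X * (1 - 'X)) ^+ n).
  by apply/funext => t; rewrite !hornerE exprMn.
(* Generalizing the polynomial frees the induction on the order of differentiation from [n]. *)
move: (_ ^+ n) => p.
suff h m : derive1n m (horner p) = horner p^`(m) by rewrite h.
by elim: m => [|m IH]; rewrite ?derivn0// derivnS derivE derive1nS IH.
Qed.

Lemma horner_bounded (p : {poly R}) :
  exists C, forall x, 0 < x < 1 -> `|p.[x]| <= C.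
Proof.
exists (\sum_(i < size p) `|p`_i|) => x /andP[x0 x1].
rewrite horner_coef (le_trans (ler_norm_sum _ _ _))//; apply: ler_sum => i _.
by rewrite normrM ler_piMr// normrX exprn_ile1// ger0_norm ltW.
Qed.

Definition log_poly N : {poly R} := \sum_(k < N) k.+1%:R^-1 *: (1 - 'X) ^+ k.
Definition beta_poly N : {poly R} :=
  \sum_(k < N) beta_coef R k n *: (1 - 'X) ^+ k.

Lemma horner_log_poly N u :
  (log_poly N).[u] = \sum_(k < N) (1 - u) ^+ k / k.+1%:R.
Proof.
by rewrite horner_sum; apply: eq_bigr => k _; rewrite !hornerE mulrC.
Qed.

Lemma horner_beta_poly N u :
  (beta_poly N).[u] = \sum_(k < N) beta_coef R k n * (1 - u) ^+ k.
Proof. by rewrite horner_sum; apply: eq_bigr => k _; rewrite !hornerE. Qed.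

(** D kills the first [n] terms, so [n + N] terms of the logarithmic series leave exactly [N]. *)
Lemma horner_euler_log_poly N u : (euler_op n (log_poly (n + N))).[u]
  = u ^+ n * \sum_(m < N) binomial_coef R n m * (1 - u) ^+ m.
Proof.
rewrite /log_poly raddf_sum/= big_split_ord/= big1 ?add0r; last first.
  by move=> i _; rewrite linearZ/= euler_op_onemXn bin_small// scale0r scaler0.
rewrite horner_sum mulr_sumr; apply: eq_bigr => m _.
rewrite linearZ/= euler_op_onemXn !(hornerZ, hornerM, hornerXn, horner_exp).
rewrite hornerD hornerN hornerX hornerC /binomial_coef [(m + n)%N]addnC addKn.
ring.
Qed.

Lemma log_poly_itv N u : 0 < u < 1 -> 0 <= (log_poly N).[u] <= log_kernel u.
Proof.
move=> u01; have /andP[u0 u1] := u01.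
have v0 : 0 <= 1 - u by rewrite subr_ge0 ltW.
rewrite horner_log_poly sumr_ge0/=; last first.
  by move=> k _; rewrite divr_ge0 ?exprn_ge0.
have h := cvg_log_series u01; rewrite -(cvg_lim _ h)//.
apply: nondecreasing_cvgn_le; last by apply/cvg_ex; eexists; exact: h.
apply/nondecreasing_seqP => M; rewrite big_ord_recr/= lerDl.
by rewrite divr_ge0 ?exprn_ge0.
Qed.

Lemma cvg_log_poly u : 0 < u < 1 ->
  (log_poly N).[u] @[N --> \oo] --> log_kernel u.
Proof.
move=> u01; apply: (eq_cvgn _ _ (cvg_log_series u01)) => // N.
by rewrite horner_log_poly.
Qed.

Lemma beta_poly_itv N u : 0 < u < 1 -> 0 <= (beta_poly N).[u] <= log_kernel u.
Proof.
move=> u01; have /andP[u0 u1] := u01.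
have v0 : 0 <= 1 - u by rewrite subr_ge0 ltW.
have /andP[_] := log_poly_itv N u01; rewrite horner_log_poly horner_beta_poly.
rewrite sumr_ge0/= => [/(le_trans _)|k _]; last first.
  by rewrite mulr_ge0 ?exprn_ge0// ltW// beta_coef_gt0.
apply; apply: ler_sum => k _.
by rewrite mulrC ler_wpM2l ?exprn_ge0// beta_coef_le.
Qed.

Lemma cvg_euler_log_beta u : 0 < u < 1 ->
  (euler_op n (log_poly (n + N)) - beta_poly N).[u] @[N --> \oo] --> (0 : R).
Proof.
move=> /andP[u0 u1]; have v01 : 0 < 1 - u < 1 by rewrite subr_gt0 u1 gtrBl.
apply: (eq_cvgn _ _ (@cvg_binomial_beta_diff R n _ v01)) => // N.
by rewrite hornerD hornerN horner_euler_log_poly horner_beta_poly subKr.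
Qed.

(** The upper bound is indirect: these values increase with [N] and share their limit with the beta
    partial sums, which stay below the kernel by termwise comparison with the logarithmic series. *)
Lemma euler_log_poly_itv N u : 0 < u < 1 ->
  0 <= (euler_op n (log_poly (n + N))).[u] <= log_kernel u.
Proof.
move=> u01; have /andP[u0 u1] := u01.
have v0 : 0 <= 1 - u by rewrite subr_ge0 ltW.
have c0 m : 0 <= binomial_coef R n m by rewrite divr_ge0.
pose S M := (beta_poly M).[u].
pose E M := (euler_op n (log_poly (n + M))).[u].
have ndS : nondecreasing_seq S.
  apply/nondecreasing_seqP => M; rewrite /S !horner_beta_poly big_ord_recr/=.
  by rewrite lerDl mulr_ge0 ?exprn_ge0// ltW// beta_coef_gt0.
have ndE : nondecreasing_seq E.
  apply/nondecreasing_seqP => M.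
  rewrite /E !horner_euler_log_poly big_ord_recr/=.
  by rewrite ler_wpM2l ?exprn_ge0 ?(ltW u0)// lerDl mulr_ge0 ?exprn_ge0.
have Sle M : S M <= log_kernel u by have /andP[] := beta_poly_itv M u01.
have cS : cvgn S.
  by apply: nondecreasing_is_cvgn => //; exists (log_kernel u) => _ [M _ <-].
have ES M : (euler_op n (log_poly (n + M)) - beta_poly M).[u] + S M = E M.
  by rewrite hornerD hornerN subrK.
have cE : E @ \oo --> limn S.
  apply: (eq_cvgn _ _ (cvgD (cvg_euler_log_beta u01) cS)); first exact: ES.
  by rewrite add0r.
apply/andP; split.
  rewrite horner_euler_log_poly mulr_ge0 ?exprn_ge0 ?(ltW u0)//.
  by apply: sumr_ge0 => m _; rewrite mulr_ge0 ?exprn_ge0.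
apply: (@le_trans _ _ (limn S)); last by apply: limr_le => //; exact: nearW.
rewrite -/(E N) -(cvg_lim _ cE)//; apply: nondecreasing_cvgn_le => //.
by apply/cvg_ex; exists (limn S).
Qed.

(** The second integration by parts: by symmetry it acts on the Legendre factor that remains. *)
Lemma bilin_onemXn k : bilin P b ((1 - 'X) ^+ k)
  = 'C(k, n)%:R * bilin b b ('X^n * (1 - 'X) ^+ (k - n)).
Proof. by rewrite bilinC bilin_legendre euler_op_onemXn linearZ. Qed.

Lemma bilin_onemXn_ge0 k : 0 <= bilin P b ((1 - 'X) ^+ k).
Proof.
rewrite bilin_onemXn mulr_ge0// bilin_ge0// => x /andP[x0 x1];
  by rewrite !hornerE ?mulr_ge0 ?exprn_ge0 ?subr_ge0// ltW.
Qed.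

Lemma bilin_onemXn_gt0 : 0 < bilin P b ((1 - 'X) ^+ n).
Proof.
rewrite bilin_onemXn binn mul1r subnn expr0 mulr1.
(* For [k = n] the double integral is the square of a one-variable beta integral. *)
rewrite /bilin coef_functionalXn mulrC -expr2 exprn_gt0// mulrC.
exact: poly_integral_Xn_onemXn.
Qed.

(** Only the term [k = n] is kept; the others are nonnegative. The bound does not depend on [N], so
    it survives the limit. *)
Lemma bilin_beta_poly_ge N : (n < N)%N ->
  beta_coef R n n * bilin P b ((1 - 'X) ^+ n) <= bilin P b (beta_poly N).
Proof.
move=> nN; rewrite /beta_poly raddf_sum/= (bigD1 (Ordinal nN))//= linearZ/=.
rewrite lerDl sumr_ge0// => k _; rewrite linearZ/= mulr_ge0 ?bilin_onemXn_ge0//.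
exact: ltW (beta_coef_gt0 _ _ _).
Qed.

Lemma square_mul_itv (z : R * R) : Q z ->
  [/\ 0 < z.1 < 1, 0 < z.2 < 1 & 0 < z.1 * z.2 < 1].
Proof.
move=> [/=]; rewrite !in_itv/= => /andP[x0 x1] /andP[y0 y1].
by split; rewrite ?x0 ?y0// mulr_gt0//= mulr_ilt1 ?ltW.
Qed.

Lemma cvg_bilin (p q : {poly R}) (h : nat -> {poly R}) (l : R -> R) :
  (forall u, 0 < u < 1 -> (h N).[u] @[N --> \oo] --> l u) ->
  (forall N u, 0 < u < 1 -> `|(h N).[u]| <= log_kernel u) ->
  bilin p q (h N) @[N --> \oo]
    --> \int[mu2]_(z in Q) (p.[z.1] * q.[z.2] * l (z.1 * z.2)).
Proof.
move=> hl hb.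
have [Cp pC] := horner_bounded p; have [Cq qC] := horner_bounded q.
apply: (cvg_has_integral2 (C := Cp * Cq)).
- by move=> N; exact: has_integral2_bilin.
- by move=> z /square_mul_itv[_ _ u01]; apply: cvgMl_tmp; exact: hl.
- move=> N z /square_mul_itv[x01 y01 u01]; rewrite !normrM.
  by rewrite !ler_pM ?mulr_ge0 ?pC ?qC ?hb.
Qed.

Lemma legendre_log_integralE : legendre_log_integral R n
  = \int[mu2]_(z in Q) (P.[z.1] * P.[z.2] * log_kernel (z.1 * z.2)).
Proof.
apply: eq_Rintegral => z _; rewrite !shifted_legendreE /log_kernel.
by rewrite !mulNr mulrN.
Qed.

Lemma cvg_bilin_log_poly :
  bilin P P (log_poly N) @[N --> \oo] --> legendre_log_integral R n.
Proof.
rewrite legendre_log_integralE.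
apply: cvg_bilin => [u|N u u01]; first exact: cvg_log_poly.
by have /andP[l0 l1] := log_poly_itv N u01; rewrite ger0_norm.
Qed.

Lemma cvg_bilin_euler_log_beta :
  bilin P b (euler_op n (log_poly (n + N)) - beta_poly N) @[N --> \oo]
    --> (0 : R).
Proof.
rewrite (_ : 0 = \int[mu2]_(z in Q) (P.[z.1] * b.[z.2] * 0)).
  apply: (cvg_bilin (l := cst 0)) => [u|N u u01].
    exact: cvg_euler_log_beta.
  have /andP[e0 e1] := euler_log_poly_itv N u01.
  have /andP[s0 s1] := beta_poly_itv N u01.
  (* Both values lie between 0 and the kernel, hence so does the absolute value of their
     difference. *)
  by rewrite hornerD hornerN ler_norml; apply/andP; split; lra.
under eq_Rintegral do rewrite mulr0.
by rewrite Rintegral_cst ?mul0r//; exact: measurable_square.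
Qed.

(** By [bilin_legendre] the integral of the logarithmic partial sum against two Legendre factors
    equals the one of its image under D against [P] and [b]; replacing that image by [beta_poly]
    changes the limit by 0. *)
Lemma cvg_bilin_beta_poly :
  bilin P b (beta_poly N) @[N --> \oo] --> legendre_log_integral R n.
Proof.
have cJ : bilin P P (log_poly (n + N)) @[N --> \oo]
    --> legendre_log_integral R n.
  move: cvg_bilin_log_poly; rewrite -(cvg_shiftn n); apply: eq_cvgn => // N.
  by rewrite /= addnC.
apply: (eq_cvgn _ _ (cvgB cJ cvg_bilin_euler_log_beta)); last by rewrite subr0.
move=> N.
have e : bilin P P (log_poly (n + N))
    - bilin P b (euler_op n (log_poly (n + N)) - beta_poly N)
    = bilin P b (beta_poly N) by rewrite bilin_legendre raddfB/= subKr.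
exact: e.
Qed.

End Positivity.

Theorem theorem5p13 (R : realType) (n : nat) : 0 < legendre_log_integral R n.
Proof.
have h := @cvg_bilin_beta_poly R n.
apply: (lt_le_trans (mulr_gt0 (beta_coef_gt0 R n n) (bilin_onemXn_gt0 R n))).
rewrite -(cvg_lim _ h)//; apply: limr_ge.
  by apply/cvg_ex; exists (legendre_log_integral R n).
near=> N; apply: bilin_beta_poly_ge; near: N; exact: nbhs_infty_gt.
Unshelve. all: by end_near. Qed.
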